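(* Let $\epsilon,\mu>0$ be constants, $\eta=\sqrt{\mu/\epsilon}$, and $J\in C^\infty(\mathbb{R}^4,\mathbb{R}^3)$. If a function pair $H,E\in C^\infty(\mathbb{R}^4,\mathbb{R}^3)$ of the variables $(x,y,z,\theta)$ satisfies Maxwell's equations $$\frac{\partial H}{\partial\theta}=-\frac1\eta\nabla\times E,\qquad \frac{\partial E}{\partial\theta}=\eta\,\nabla\times H-\eta J,$$ then for any integer $n\ge0$ $$\frac{\partial^{2n+1}H}{\partial\theta^{2n+1}}=\frac1\eta(-1)^{n+1}(\nabla\times)^{2n+1}E+J_{h,2n+1},\qquad \frac{\partial^{2n+2}H}{\partial\theta^{2n+2}}=(-1)^{n+1}(\nabla\times)^{2n+2}H+J_{h,2n+2},$$ $$\frac{\partial^{2n+1}E}{\partial\theta^{2n+1}}=\eta(-1)^{n}(\nabla\times)^{2n+1}H+\eta J_{e,2n+1},\qquad \frac{\partial^{2n+2}E}{\partial\theta^{2n+2}}=(-1)^{n+1}(\nabla\times)^{2n+2}E+\eta J_{e,2n+2},$$ where the source terms are given by $$J_{h,1}=0,\qquad J_{h,2n+1}=\sum_{m=1}^{n}(-1)^{m+1}(\nabla\times)^{2m-1}\frac{\partial^{2(n-m)+1}J}{\partial\theta^{2(n-m)+1}}\quad(n>0),$$ $$J_{h,2n+2}=\sum_{m=0}^{n}(-1)^{m}(\nabla\times)^{2m+1}\frac{\partial^{2(n-m)}J}{\partial\theta^{2(n-m)}},$$ $$J_{e,2n+1}=\sum_{m=0}^{n}(-1)^{m+1}(\nabla\times)^{2m}\frac{\partial^{2(n-m)}J}{\partial\theta^{2(n-m)}},\qquad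 J_{e,2n+2}=\sum_{m=0}^{n}(-1)^{m+1}(\nabla\times)^{2m}\frac{\partial^{2(n-m)+1}J}{\partial\theta^{2(n-m)+1}}.$$
   Context: The repeated curl is defined by $(\nabla\times)^0F=F$ and $(\nabla\times)^nF=\nabla\times\left((\nabla\times)^{n-1}F\right)$ for $n\ge1$; all curls act in the space variables $(x,y,z)$ only, with $\theta$ held fixed. All identities hold at every $(x,y,z,\theta)\in\mathbb{R}^4$. *)

(* Defs.v *)
From Stdlib Require Import Reals List.
From Coquelicot Require Import Coquelicot.
Open Scope R_scope.

(** Stdlib reals with Coquelicot.  Points of R^4 are [(x, y, z, theta)]; the
    uniform, abelian-group and module structures on [R * R * R * R] and
    [R * R * R] are Coquelicot's canonical product structures. *)
Definition R3 : Type := (R * R * R)%type.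
Definition R4 : Type := (R * R * R * R)%type.

Inductive axis : Set := ax_x | ax_y | ax_z | ax_theta.

Definition coord (i : axis) (p : R4) : R :=
  let '(x, y, z, th) := p in
  match i with ax_x => x | ax_y => y | ax_z => z | ax_theta => th end.

Definition upd (i : axis) (p : R4) (s : R) : R4 :=
  let '(x, y, z, th) := p in
  match i with
  | ax_x => (s, y, z, th)
  | ax_y => (x, s, z, th)
  | ax_z => (x, y, s, th)
  | ax_theta => (x, y, z, s)
  end.

(** [Derive] and [Derive_n] are total: they are meaningful only where the
    derivative exists, which [smooth] below guarantees. *)
Definition ex_partial (i : axis) (f : R4 -> R) (p : R4) : Prop :=
  ex_derive (fun s => f (upd i p s)) (coord i p).

Definition partial_n (i : axis) (n : nat) (f : R4 -> R) (p : R4) : R :=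
  Derive_n (fun s => f (upd i p s)) n (coord i p).

Definition partial (i : axis) (f : R4 -> R) (p : R4) : R :=
  Derive (fun s => f (upd i p s)) (coord i p).

(** C^oo(R^4, R): iterated partial derivatives of every order, in every
    sequence of directions, exist and are (jointly) continuous on R^4. *)
Definition smooth (f : R4 -> R) : Prop :=
  forall (l : list axis) (p : R4),
    continuous (fold_right partial f l) p /\
    forall i : axis, ex_partial i (fold_right partial f l) p.

Definition c1 (v : R3) : R := fst (fst v).
Definition c2 (v : R3) : R := snd (fst v).
Definition c3 (v : R3) : R := snd v.

Definition smooth3 (F : R4 -> R3) : Prop :=
  smooth (fun p => c1 (F p)) /\ smooth (fun p => c2 (F p)) /\
  smooth (fun p => c3 (F p)).

Definition dtheta (n : nat) (F : R4 -> R3) (p : R4) : R3 :=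
  (partial_n ax_theta n (fun q => c1 (F q)) p,
   partial_n ax_theta n (fun q => c2 (F q)) p,
   partial_n ax_theta n (fun q => c3 (F q)) p).

Definition curl (F : R4 -> R3) (p : R4) : R3 :=
  let F1 q := c1 (F q) in
  let F2 q := c2 (F q) in
  let F3 q := c3 (F q) in
  (partial ax_y F3 p - partial ax_z F2 p,
   partial ax_z F1 p - partial ax_x F3 p,
   partial ax_x F2 p - partial ax_y F1 p).

Definition curl_n (n : nat) (F : R4 -> R3) : R4 -> R3 := Nat.iter n curl F.

(** Source terms: [Jh_odd J n] is J_{h,2n+1}, [Jh_even J n] is J_{h,2n+2},
    [Je_odd J n] is J_{e,2n+1} and [Je_even J n] is J_{e,2n+2}.  The sums are
    over m with both bounds included, so the natural-number subtractions are
    never truncated. *)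
Definition Jh_odd (J : R4 -> R3) (n : nat) (p : R4) : R3 :=
  match n with
  | O => zero
  | S _ =>
      sum_n_m (fun m => scal ((-1) ^ (m + 1))
        (curl_n (2 * m - 1) (dtheta (2 * (n - m) + 1) J) p)) 1 n
  end.

Definition Jh_even (J : R4 -> R3) (n : nat) (p : R4) : R3 :=
  sum_n_m (fun m => scal ((-1) ^ m)
    (curl_n (2 * m + 1) (dtheta (2 * (n - m)) J) p)) 0 n.

Definition Je_odd (J : R4 -> R3) (n : nat) (p : R4) : R3 :=
  sum_n_m (fun m => scal ((-1) ^ (m + 1))
    (curl_n (2 * m) (dtheta (2 * (n - m)) J) p)) 0 n.

Definition Je_even (J : R4 -> R3) (n : nat) (p : R4) : R3 :=
  sum_n_m (fun m => scal ((-1) ^ (m + 1))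
    (curl_n (2 * m) (dtheta (2 * (n - m) + 1) J) p)) 0 n.

(* Main.v *)
From Stdlib Require Import Reals List Lia FunctionalExtensionality.
From Coquelicot Require Import Coquelicot.
Require Import Defs.
Open Scope R_scope.

(** Write D for the time derivative and C for the curl.  Both are linear on
    smooth fields, and D C = C D because mixed partial derivatives commute
    ([partial_comm], from which [dtheta1_curl_n]).  Maxwell's equations read
    D H = -(1/eta) C E and D E = eta C H - eta J, so D maps
    a C^m E + S to a eta C^(m+1) H - a eta C^m J + D S, and it maps a C^m H + S
    to -(a/eta) C^(m+1) E + D S, without a new term in J.

    Induction on the order of the time derivative therefore proves the four
    identities as soon as the source terms obey the matching recursion: whenever
    the step differentiates a curl power of E, the new source is the D-image of
    the old one plus a signed term C^m J; whenever it differentiates a curl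
    power of H, it is the D-image alone.  Here m is 2n+1 in passing from D^(2n+1) H
    to D^(2n+2) H, and 2n+2 in passing from D^(2n+2) E to D^(2n+3) E.  The four
    recursions ([Jh_odd_rec], [Jh_even_rec], [Je_odd_rec], [Je_even_rec]) follow
    by differentiating the closed sums term by term ([dtheta1_source_sum]) and
    splitting off or shifting a summand.

    Identities between fields are stated as equalities of functions, so that
    they can be rewritten under [curl] and [dtheta]. *)

(** * Calculus of smooth scalar functions *)

Lemma smooth_partial (i : axis) (f : R4 -> R) :
  smooth f -> smooth (partial i f).
Proof.
  intros Hf l p. generalize (Hf (l ++ i :: nil) p).
  now rewrite fold_right_app.
Qed.

Lemma partial_lin (i : axis) (a b : R) (f g : R4 -> R) :
  (forall p, ex_partial i f p) -> (forall p, ex_partial i g p) ->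
  partial i (fun p => a * f p + b * g p)
  = (fun p => a * partial i f p + b * partial i g p).
Proof.
  intros Hf Hg. apply functional_extensionality; intros p. unfold partial.
  rewrite Derive_plus by (apply ex_derive_scal; [apply Hf || apply Hg]).
  now rewrite !Derive_scal.
Qed.

(** Linearity has to be carried through the whole list of derivatives at once:
    [smooth] speaks of all of them, and [partial] of a sum splits only where
    both summands are differentiable. *)
Lemma smooth_lin (a b : R) (f g : R4 -> R) :
  smooth f -> smooth g -> smooth (fun p => a * f p + b * g p).
Proof.
  intros Hf Hg l.
  assert (E : fold_right partial (fun p => a * f p + b * g p) l
    = (fun p => a * fold_right partial f l p + b * fold_right partial g l p)).
  { induction l as [|i l IH]; simpl; [reflexivity|].
    rewrite IH. apply partial_lin; intros p; [apply Hf | apply Hg]. }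
  intros p. rewrite E.
  destruct (Hf l p) as [Cf Df], (Hg l p) as [Cg Dg]. split.
  - apply (continuous_plus (V := R_NormedModule)
      (fun p => a * fold_right partial f l p)
      (fun p => b * fold_right partial g l p));
      now apply (continuous_scal_r (V := R_NormedModule)).
  - intros i. apply (ex_derive_plus (V := R_NormedModule)
      (fun s => a * fold_right partial f l (upd i p s))
      (fun s => b * fold_right partial g l (upd i p s)));
      apply ex_derive_scal; [apply Df | apply Dg].
Qed.

(** Varying two coordinates is a continuous map from the plane to R^4, as each
    coordinate of its value is one of the two parameters or a constant. *)
Lemma continuity_2d_section (i j : axis) (g : R4 -> R) (p : R4) (u v : R) :
  (forall q, continuous g q) ->
  continuity_2d_pt (fun s t => g (upd j (upd i p s) t)) u v.
Proof.
  intros Cg. apply continuity_2d_pt_filterlim.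
  apply (continuous_comp
    (fun z : R * R => upd j (upd i p (fst z)) (snd z) : R * R * R * R) g);
    [|apply Cg].
  apply filterlim_locally. intros eps. exists eps. intros [s t] [Hs Ht].
  destruct p as [[[x y] z] th].
  destruct i, j; repeat split; simpl; first [exact Hs | exact Ht | apply ball_center].
Qed.

(** Schwarz's theorem, applied to the two-variable section of [f] along the
    axes [i] and [j]; it needs the joint continuity of the second
    derivatives. *)
Lemma partial_comm (i j : axis) (f : R4 -> R) :
  smooth f -> partial i (partial j f) = partial j (partial i f).
Proof.
  intros Hf. apply functional_extensionality; intros p.
  pose (h := fun u v => f (upd j (upd i p u) v)).
  assert (C : forall k l q, continuous (partial k (partial l f)) q)
    by (intros k l q; apply (Hf (k :: l :: nil) q)).
  assert (D1 : forall k q, ex_partial k f q)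
    by (intros k q; apply (Hf nil q)).
  assert (D2 : forall k l q, ex_partial k (partial l f) q)
    by (intros k l q; apply (Hf (l :: nil) q)).
  assert (K1 := fun u v => continuity_2d_section i j _ p u v (C i j)).
  assert (K2 := fun u v => continuity_2d_section i j _ p u v (C j i)).
  assert (Q := fun u v => D1 i (upd j (upd i p u) v)).
  assert (Q' := fun u v => D1 j (upd j (upd i p u) v)).
  assert (Q2 := fun u v => D2 i j (upd j (upd i p u) v)).
  assert (Q2' := fun u v => D2 j i (upd j (upd i p u) v)).
  assert (S := Schwarz h (coord i p) (coord j p)).
  (* On explicit axes, [upd] and [coord] compute, and the partial derivatives
     of [f] become the iterated derivatives of [h]. *)
  destruct p as [[[x y] z] th].
  destruct i, j; try reflexivity;
  (apply S; [apply locally_2d_forall; intros u v; repeat split;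
     [exact (Q u v) | exact (Q' u v) | exact (Q2 u v) | exact (Q2' u v)]
   | exact (K1 _ _) | exact (K2 _ _)]).
Qed.

(** * The linear operators curl and time derivative on smooth fields *)

(** Every linear combination below has two terms; fields with a single term
    are written with a coefficient 0. *)
Definition lin (a : R) (F : R4 -> R3) (b : R) (G : R4 -> R3) : R4 -> R3 :=
  fun p => plus (scal a (F p)) (scal b (G p)).

Lemma R3_ext (v w : R3) : c1 v = c1 w -> c2 v = c2 w -> c3 v = c3 w -> v = w.
Proof.
  destruct v as [[? ?] ?], w as [[? ?] ?]; unfold c1, c2, c3; simpl.
  now intros -> -> ->.
Qed.

(** The module operations of R^3 are nested product structures; unfolding twice
    turns them into operations on R in each coordinate. *)
Ltac R3_ring :=
  apply R3_ext; unfold c1, c2, c3, minus, plus, opp, scal, zero;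
  simpl; unfold minus, plus, opp, scal, mult, zero; simpl;
  unfold mult; simpl; try ring.

Lemma smooth3_lin a F b G : smooth3 F -> smooth3 G -> smooth3 (lin a F b G).
Proof.
  intros (F1 & F2 & F3) (G1 & G2 & G3).
  split; [|split].
  - exact (smooth_lin a b _ _ F1 G1).
  - exact (smooth_lin a b _ _ F2 G2).
  - exact (smooth_lin a b _ _ F3 G3).
Qed.

Lemma smooth_minus (f g : R4 -> R) :
  smooth f -> smooth g -> smooth (fun p => f p - g p).
Proof.
  intros Hf Hg.
  replace (fun p => f p - g p) with (fun p => 1 * f p + (-1) * g p)
    by (apply functional_extensionality; intros; ring).
  now apply smooth_lin.
Qed.

Lemma smooth3_curl F : smooth3 F -> smooth3 (curl F).
Proof.
  intros (F1 & F2 & F3).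
  split; [|split]; apply smooth_minus; now apply smooth_partial.
Qed.

Lemma smooth3_dtheta1 F : smooth3 F -> smooth3 (dtheta 1 F).
Proof.
  intros (F1 & F2 & F3).
  split; [|split];
    [ exact (smooth_partial ax_theta _ F1) | exact (smooth_partial ax_theta _ F2)
    | exact (smooth_partial ax_theta _ F3) ].
Qed.

Lemma partial_smooth_lin i a b f g : smooth f -> smooth g ->
  partial i (fun p => a * f p + b * g p)
  = (fun p => a * partial i f p + b * partial i g p).
Proof.
  intros Hf Hg; apply partial_lin; intros p; [apply (Hf nil) | apply (Hg nil)].
Qed.

Lemma curl_lin a F b G : smooth3 F -> smooth3 G ->
  curl (lin a F b G) = lin a (curl F) b (curl G).
Proof.
  intros (F1 & F2 & F3) (G1 & G2 & G3).
  assert (L1 := fun i => partial_smooth_lin i a b _ _ F1 G1).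
  assert (L2 := fun i => partial_smooth_lin i a b _ _ F2 G2).
  assert (L3 := fun i => partial_smooth_lin i a b _ _ F3 G3).
  apply functional_extensionality; intros p.
  unfold curl.
  change (fun q => c1 (lin a F b G q)) with (fun q => a * c1 (F q) + b * c1 (G q)).
  change (fun q => c2 (lin a F b G q)) with (fun q => a * c2 (F q) + b * c2 (G q)).
  change (fun q => c3 (lin a F b G q)) with (fun q => a * c3 (F q) + b * c3 (G q)).
  rewrite !L1, !L2, !L3. unfold lin. R3_ring.
Qed.

Lemma dtheta1_lin a F b G : smooth3 F -> smooth3 G ->
  dtheta 1 (lin a F b G) = lin a (dtheta 1 F) b (dtheta 1 G).
Proof.
  intros (F1 & F2 & F3) (G1 & G2 & G3).
  apply functional_extensionality; intros p.
  apply R3_ext.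
  - exact (f_equal (fun h => h p) (partial_smooth_lin ax_theta a b _ _ F1 G1)).
  - exact (f_equal (fun h => h p) (partial_smooth_lin ax_theta a b _ _ F2 G2)).
  - exact (f_equal (fun h => h p) (partial_smooth_lin ax_theta a b _ _ F3 G3)).
Qed.

(** Each component of the curl is a difference of two space derivatives, and
    each of these commutes with the time derivative. *)
Lemma dtheta1_curl F : smooth3 F -> dtheta 1 (curl F) = curl (dtheta 1 F).
Proof.
  intros (F1 & F2 & F3).
  assert (M : forall f g, smooth f -> smooth g ->
    partial ax_theta (fun p => f p - g p)
    = (fun p => partial ax_theta f p - partial ax_theta g p)).
  { intros f g Hf Hg. apply functional_extensionality; intros p.
    apply Derive_minus; [apply (Hf nil) | apply (Hg nil)]. }
  apply functional_extensionality; intros p.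
  assert (X : forall i j f g, smooth f -> smooth g ->
    partial ax_theta (fun q => partial i f q - partial j g q) p
    = partial i (partial ax_theta f) p - partial j (partial ax_theta g) p).
  { intros i j f g Hf Hg. rewrite M by now apply smooth_partial.
    now rewrite (partial_comm ax_theta i), (partial_comm ax_theta j). }
  apply R3_ext; now apply X.
Qed.

Lemma dtheta_0 F : dtheta 0 F = F.
Proof.
  apply functional_extensionality; intros [[[x y] z] th].
  now apply R3_ext.
Qed.

Lemma dtheta_S n F : dtheta (S n) F = dtheta 1 (dtheta n F).
Proof.
  apply functional_extensionality; intros [[[x y] z] th].
  now apply R3_ext.
Qed.

Lemma curl_n_S n F : curl_n (S n) F = curl (curl_n n F).
Proof. reflexivity. Qed.

Lemma curl_n_curl n F : curl_n n (curl F) = curl_n (S n) F.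
Proof. induction n as [|n IH]; [reflexivity|]. now rewrite !curl_n_S, IH. Qed.

Lemma smooth3_dtheta n F : smooth3 F -> smooth3 (dtheta n F).
Proof.
  intros HF. induction n as [|n IH]; [now rewrite dtheta_0|].
  rewrite (dtheta_S n F). now apply smooth3_dtheta1.
Qed.

Lemma smooth3_curl_n n F : smooth3 F -> smooth3 (curl_n n F).
Proof. intros HF. induction n; [exact HF | now apply smooth3_curl]. Qed.

Lemma curl_n_lin n a F b G : smooth3 F -> smooth3 G ->
  curl_n n (lin a F b G) = lin a (curl_n n F) b (curl_n n G).
Proof.
  intros HF HG. induction n as [|n IH]; [reflexivity|].
  rewrite !curl_n_S, IH. apply curl_lin; now apply smooth3_curl_n.
Qed.

Lemma dtheta1_curl_n n F : smooth3 F ->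
  dtheta 1 (curl_n n F) = curl_n n (dtheta 1 F).
Proof.
  intros HF. induction n as [|n IH]; [reflexivity|].
  rewrite !curl_n_S, dtheta1_curl, IH; [reflexivity|].
  now apply smooth3_curl_n.
Qed.

Lemma dtheta1_curl_n_dtheta n m F : smooth3 F ->
  dtheta 1 (curl_n n (dtheta m F)) = curl_n n (dtheta (S m) F).
Proof.
  intros HF. rewrite (dtheta_S m F). apply dtheta1_curl_n.
  exact (smooth3_dtheta m F HF).
Qed.

(** * Recursion for the source terms *)

(** The common shape of the four source terms, so that differentiating and
    re-indexing are done once for all of them. *)
Definition source_sum (J : R4 -> R3) (c : nat -> R) (k d : nat -> nat)
    (a b : nat) : R4 -> R3 :=
  fun p => sum_n_m (fun m => scal (c m) (curl_n (k m) (dtheta (d m) J) p)) a b.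

Lemma source_sum_step J c k d a b : (a <= S b)%nat ->
  source_sum J c k d a (S b)
  = lin 1 (source_sum J c k d a b)
        (c (S b)) (curl_n (k (S b)) (dtheta (d (S b)) J)).
Proof.
  intros Hab. apply functional_extensionality; intros p.
  unfold source_sum, lin. rewrite sum_n_Sm by exact Hab.
  R3_ring.
Qed.

Lemma source_sum_empty J c k d a b : (b < a)%nat ->
  source_sum J c k d a b = (fun _ => zero).
Proof.
  intros Hba. apply functional_extensionality; intros p.
  now apply sum_n_m_zero.
Qed.

Lemma source_sum_ext J c k d c' k' d' a b :
  (forall m, (a <= m <= b)%nat -> c m = c' m /\ k m = k' m /\ d m = d' m) ->
  source_sum J c k d a b = source_sum J c' k' d' a b.
Proof.
  intros Hm. apply functional_extensionality; intros p.
  apply sum_n_m_ext_loc; intros m Hab.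
  destruct (Hm m Hab) as (-> & -> & ->). reflexivity.
Qed.

Lemma source_sum_shift J c k d a b :
  source_sum J c k d (S a) (S b)
  = source_sum J (fun m => c (S m)) (fun m => k (S m)) (fun m => d (S m)) a b.
Proof.
  apply functional_extensionality; intros p.
  symmetry. apply (sum_n_m_S (fun m => scal (c m) (curl_n (k m) (dtheta (d m) J) p))).
Qed.

Lemma zero_lin (F : R4 -> R3) : (fun _ => zero) = lin 0 F 0 F.
Proof. apply functional_extensionality; intros p. unfold lin. R3_ring. Qed.

(** Smoothness and the derivative are obtained in one induction: the sum can be
    differentiated term by term because its partial sums are smooth. *)
Lemma source_sum_smooth_dtheta1 J c k d a b : smooth3 J ->
  smooth3 (source_sum J c k d a b) /\
  dtheta 1 (source_sum J c k d a b)
  = source_sum J c k (fun m => S (d m)) a b.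
Proof.
  intros HJ.
  assert (HZ : forall b, (b < a)%nat -> smooth3 (source_sum J c k d a b) /\
    dtheta 1 (source_sum J c k d a b) = source_sum J c k (fun m => S (d m)) a b).
  { intros b' Hb. rewrite !source_sum_empty, (zero_lin J) by exact Hb. split.
    - now apply smooth3_lin.
    - rewrite dtheta1_lin by assumption. now rewrite <- !zero_lin. }
  assert (HT : forall m, smooth3 (curl_n (k m) (dtheta (d m) J)))
    by (intros m; now apply smooth3_curl_n, smooth3_dtheta).
  assert (HS : forall b, (a <= S b)%nat ->
    smooth3 (source_sum J c k d a b) /\
    dtheta 1 (source_sum J c k d a b) = source_sum J c k (fun m => S (d m)) a b ->
    smooth3 (source_sum J c k d a (S b)) /\
    dtheta 1 (source_sum J c k d a (S b))
    = source_sum J c k (fun m => S (d m)) a (S b)).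
  { intros b' Hb [Hs Hd]. rewrite !source_sum_step by exact Hb. split.
    - now apply smooth3_lin.
    - rewrite (dtheta1_lin _ _ _ _ Hs (HT _)), Hd.
      now rewrite (dtheta1_curl_n_dtheta _ _ J HJ). }
  induction b as [|b IH].
  - destruct a as [|a]; [|apply HZ; lia].
    (* With both bounds 0 there is no preceding partial sum to extend. *)
    assert (E : forall d, source_sum J c k d 0 0
      = lin (c 0%nat) (curl_n (k 0%nat) (dtheta (d 0%nat) J)) 0 J).
    { intros d'. apply functional_extensionality; intros p.
      unfold source_sum, lin. rewrite sum_n_n. R3_ring. }
    rewrite !E. split; [now apply smooth3_lin|].
    rewrite (dtheta1_lin _ _ _ _ (HT _) HJ), (dtheta1_curl_n_dtheta _ _ J HJ).
    apply functional_extensionality; intros p. unfold lin. R3_ring.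
  - destruct (Nat.lt_ge_cases (S b) a); [now apply HZ | now apply HS].
Qed.

Lemma dtheta1_source_sum J c k d a b : smooth3 J ->
  dtheta 1 (source_sum J c k d a b) = source_sum J c k (fun m => S (d m)) a b.
Proof. intros HJ. now apply source_sum_smooth_dtheta1. Qed.

(** The case n = 0 of the definition agrees with the sum over 1 <= m <= 0. *)
Lemma Jh_odd_source_sum J n :
  Jh_odd J n = source_sum J (fun m => (-1) ^ (m + 1))
    (fun m => 2 * m - 1)%nat (fun m => 2 * (n - m) + 1)%nat 1 n.
Proof.
  destruct n; [|reflexivity].
  now rewrite source_sum_empty by constructor.
Qed.

Lemma Jh_even_source_sum J n :
  Jh_even J n = source_sum J (fun m => (-1) ^ m)
    (fun m => 2 * m + 1)%nat (fun m => 2 * (n - m))%nat 0 n.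
Proof. reflexivity. Qed.

Lemma Je_odd_source_sum J n :
  Je_odd J n = source_sum J (fun m => (-1) ^ (m + 1))
    (fun m => 2 * m)%nat (fun m => 2 * (n - m))%nat 0 n.
Proof. reflexivity. Qed.

Lemma Je_even_source_sum J n :
  Je_even J n = source_sum J (fun m => (-1) ^ (m + 1))
    (fun m => 2 * m)%nat (fun m => 2 * (n - m) + 1)%nat 0 n.
Proof. reflexivity. Qed.

Lemma source_smooth J n : smooth3 J ->
  smooth3 (Jh_odd J n) /\ smooth3 (Jh_even J n) /\
  smooth3 (Je_odd J n) /\ smooth3 (Je_even J n).
Proof.
  intros HJ. rewrite Jh_odd_source_sum.
  split; [|split; [|split]];
    exact (proj1 (source_sum_smooth_dtheta1 J _ _ _ _ _ HJ)).
Qed.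

Lemma Jh_odd_rec J n : smooth3 J -> Jh_odd J (S n) = dtheta 1 (Jh_even J n).
Proof.
  intros HJ. rewrite Jh_odd_source_sum, Jh_even_source_sum, source_sum_shift.
  rewrite dtheta1_source_sum by exact HJ.
  apply source_sum_ext; intros m Hm. repeat split; try lia.
  rewrite pow_add; simpl; ring.
Qed.

Lemma Je_even_rec J n : smooth3 J -> Je_even J n = dtheta 1 (Je_odd J n).
Proof.
  intros HJ. rewrite Je_even_source_sum, Je_odd_source_sum.
  rewrite dtheta1_source_sum by exact HJ.
  apply source_sum_ext; intros m Hm. repeat split; lia.
Qed.

(** The last summand carries no time derivative of [J]; the others are the
    differentiated summands of [Jh_odd J n], with the index shifted by one. *)
Lemma Jh_even_rec J n : smooth3 J ->
  Jh_even J n = lin 1 (dtheta 1 (Jh_odd J n)) ((-1) ^ n) (curl_n (2 * n + 1) J).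
Proof.
  intros HJ. rewrite Jh_odd_source_sum, dtheta1_source_sum by exact HJ.
  destruct n as [|n].
  - rewrite source_sum_empty by lia.
    apply functional_extensionality; intros p.
    unfold Jh_even, lin. rewrite sum_n_n. simpl Nat.mul. rewrite dtheta_0. R3_ring.
  - rewrite Jh_even_source_sum.
    rewrite source_sum_step, source_sum_shift, Nat.sub_diag, dtheta_0 by lia.
    f_equal. apply source_sum_ext; intros m Hm. repeat split; try lia.
    rewrite pow_add; simpl; ring.
Qed.

Lemma Je_odd_rec J n : smooth3 J ->
  Je_odd J (S n)
  = lin 1 (dtheta 1 (Je_even J n)) ((-1) ^ n) (curl_n (2 * n + 2) J).
Proof.
  intros HJ. rewrite Je_even_source_sum, dtheta1_source_sum by exact HJ.
  rewrite Je_odd_source_sum.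
  rewrite source_sum_step, Nat.sub_diag, dtheta_0 by lia.
  f_equal.
  - apply source_sum_ext; intros m Hm. repeat split; lia.
  - rewrite pow_add; simpl; ring.
  - f_equal; lia.
Qed.

(** * The identities for the time derivatives *)

(** The inductive step before Maxwell's equations are substituted. *)
Lemma dtheta_S_lin F G S0 k m a b : smooth3 G -> smooth3 S0 ->
  dtheta k F = lin a (curl_n m G) b S0 ->
  dtheta (S k) F = lin a (curl_n m (dtheta 1 G)) b (dtheta 1 S0).
Proof.
  intros HG HS E. rewrite (dtheta_S k F), E, dtheta1_lin, dtheta1_curl_n;
    auto using smooth3_curl_n.
Qed.

Lemma lin_ext a F b G a' F' b' G' :
  (forall p, lin a F b G p = lin a' F' b' G' p) ->
  lin a F b G = lin a' F' b' G'.
Proof. apply functional_extensionality. Qed.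

Theorem theorem8 :
  forall (epsilon mu eta : R) (J H E : R4 -> R3),
  0 < epsilon -> 0 < mu -> eta = sqrt (mu / epsilon) ->
  smooth3 J -> smooth3 H -> smooth3 E ->
  (forall p : R4, dtheta 1 H p = scal (- (1 / eta)) (curl E p)) ->
  (forall p : R4, dtheta 1 E p = minus (scal eta (curl H p)) (scal eta (J p))) ->
  forall (n : nat) (p : R4),
    dtheta (2 * n + 1) H p =
      plus (scal (1 / eta * (-1) ^ (n + 1)) (curl_n (2 * n + 1) E p))
           (Jh_odd J n p) /\
    dtheta (2 * n + 2) H p =
      plus (scal ((-1) ^ (n + 1)) (curl_n (2 * n + 2) H p))
           (Jh_even J n p) /\
    dtheta (2 * n + 1) E p =
      plus (scal (eta * (-1) ^ n) (curl_n (2 * n + 1) H p))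
           (scal eta (Je_odd J n p)) /\
    dtheta (2 * n + 2) E p =
      plus (scal ((-1) ^ (n + 1)) (curl_n (2 * n + 2) E p))
           (scal eta (Je_even J n p)).
Proof.
  intros epsilon mu eta J H E Heps Hmu Heta HJ HH HE MH ME.
  assert (eta0 : eta <> 0).
  { rewrite Heta. apply Rgt_not_eq, sqrt_lt_R0. now apply Rdiv_lt_0_compat. }
  assert (MH' : dtheta 1 H = lin (- (1 / eta)) (curl E) 0 J).
  { apply functional_extensionality; intros p. rewrite MH. unfold lin. R3_ring. }
  assert (ME' : dtheta 1 E = lin eta (curl H) (- eta) J).
  { apply functional_extensionality; intros p. rewrite ME. unfold lin. R3_ring. }
  assert (CH : forall m, curl_n m (dtheta 1 H)
    = lin (- (1 / eta)) (curl_n (S m) E) 0 (curl_n m J)).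
  { intros m. rewrite MH', curl_n_lin, curl_n_curl;
      auto using smooth3_curl. }
  assert (CE : forall m, curl_n m (dtheta 1 E)
    = lin eta (curl_n (S m) H) (- eta) (curl_n m J)).
  { intros m. rewrite ME', curl_n_lin, curl_n_curl;
      auto using smooth3_curl. }
  clear Heta MH ME.
  assert (odd_to_even : forall n,
    dtheta (2 * n + 1) H = lin (1 / eta * (-1) ^ (n + 1)) (curl_n (2 * n + 1) E)
      1 (Jh_odd J n) /\
    dtheta (2 * n + 1) E = lin (eta * (-1) ^ n) (curl_n (2 * n + 1) H)
      eta (Je_odd J n) ->
    dtheta (2 * n + 2) H = lin ((-1) ^ (n + 1)) (curl_n (2 * n + 2) H)
      1 (Jh_even J n) /\
    dtheta (2 * n + 2) E = lin ((-1) ^ (n + 1)) (curl_n (2 * n + 2) E)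
      eta (Je_even J n)).
  { intros n [OH OE]. destruct (source_smooth J n HJ) as (S1 & S2 & S3 & S4).
    rewrite Jh_even_rec, Je_even_rec by exact HJ.
    replace (2 * n + 2)%nat with (S (2 * n + 1)) by lia.
    rewrite (dtheta_S_lin _ _ _ _ _ _ _ HE S1 OH), (dtheta_S_lin _ _ _ _ _ _ _ HH S3 OE).
    rewrite CH, CE, pow_add.
    split; apply lin_ext; intros p; unfold lin; R3_ring; field; assumption. }
  assert (odd : forall n,
    dtheta (2 * n + 1) H = lin (1 / eta * (-1) ^ (n + 1)) (curl_n (2 * n + 1) E)
      1 (Jh_odd J n) /\
    dtheta (2 * n + 1) E = lin (eta * (-1) ^ n) (curl_n (2 * n + 1) H)
      eta (Je_odd J n)).
  { induction n as [|n IH].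
    - simpl Nat.mul; simpl Nat.add. rewrite MH', ME'.
      split; apply lin_ext; intros p; unfold lin.
      + R3_ring.
      + unfold Je_odd. rewrite sum_n_n. simpl Nat.mul. rewrite dtheta_0. R3_ring.
    - destruct (odd_to_even n IH) as [EH EE].
      destruct (source_smooth J n HJ) as (S1 & S2 & S3 & S4).
      rewrite Jh_odd_rec, Je_odd_rec by exact HJ.
      replace (2 * S n + 1)%nat with (S (2 * n + 2)) by lia.
      rewrite (dtheta_S_lin _ _ _ _ _ _ _ HH S2 EH), (dtheta_S_lin _ _ _ _ _ _ _ HE S4 EE).
      rewrite CH, CE. replace (S n + 1)%nat with (S (S n)) by lia.
      rewrite pow_add.
      split; apply lin_ext; intros p; unfold lin; R3_ring; field; assumption. }
  assert (unit : forall a F G p, lin a F 1 G p = plus (scal a (F p)) (G p)).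
  { intros. unfold lin. R3_ring. }
  intros n p.
  destruct (odd n) as [OH OE]; destruct (odd_to_even n (odd n)) as [EH EE].
  rewrite OH, OE, EH, EE, !unit. repeat split.
Qed.
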